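(* Let $W:\mathbb{R}_+\times\mathbb{R}\times\mathcal{I}\to\mathbb{R}$ be a separable weighting of the form $W(E,x_1,x_2)=W_1(E)W_2(x_1,x_2)$, where $W_1\in C^1(\mathbb{R}_+)$ and $W_2\in C^1(\mathbb{R}\times\mathcal{I})$ are non-vanishing, $W_2$ is symmetric about $x_1=0$, and, for any $x_2\in\mathcal{I}$, $W_2(\cdot,x_2)\in C^1(\mathbb{R})$ is bounded and has bounded first order derivative (in $x_1$) on $[-w(x_2),w(x_2)]$. Assume further that $W_1$ is bounded on $\mathfrak{E}$ and that $\Phi'$ is bounded on $\mathcal{I}$. Then the Bragg transform $\mathfrak{B}:L^2_0(\mathfrak{E}\times\mathbb{R}\times\mathcal{I})\to L^2(\mathfrak{E}\times\mathbb{R}\times\Phi(\mathcal{I}))$ is a bounded operator (with respect to the $L^2$ norms).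
   Context: Notation: $\mathbb{R}_+=(0,\infty)$, $\mathcal{I}=(-1,1)$, and $\mathfrak{E}=[E_m,E_M]$ with $0<E_m<E_M$ fixed. $L^2_0(\Omega)$ is the set of (real-valued) $L^2$ functions with compact support on $\Omega$; $f\in L^2_0(\mathfrak{E}\times\mathbb{R}\times\mathcal{I})$ is extended by zero to values of its first variable $q$ outside $\mathfrak{E}$. $\chi_S$ is the characteristic function of a set $S$. ''Non-vanishing'' means nowhere zero. Fix $\beta\in(0,\pi)$ and set $w(x_2)=(1+x_2)\tan\frac{\beta}{2}$ for $x_2\in\mathcal{I}$. Fix a diffeomorphism $\Phi:\mathcal{I}\to\Phi(\mathcal{I})\subset\mathbb{R}$ with $0\le\Phi(x_2)\le M$ for all $x_2\in\mathcal{I}$, for some $M>0$. For $x_2\in\mathcal{I}$ define $$q_1(x_1)=q_1(x_1;x_2)=\frac{1}{\sqrt2}\sqrt{1+\frac{x_1^2-(1-x_2^2)}{\sqrt{x_1^2+(x_2+1)^2}\,\sqrt{x_1^2+(1-x_2)^2}}},\qquad x_1\in\mathbb{R}.$$ The Bragg transform (with weighting $W$) is $$\mathfrak{B}f(E,s_1,\Phi(x_2))=\int_{\mathbb{R}}\chi_{[-w(x_2),w(x_2)]}(x_1-s_1)\,W(E,x_1-s_1,x_2)\,f(Eq_1(x_1-s_1),x_1,x_2)\,\mathrm{d}x_1,$$ where here the variable $E$ is restricted to $\mathfrak{E}$, $s_1\in\mathbb{R}$, and $x_2\in\mathcal{I}$.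
   Formalization: The bound on W_2(·,x_2) over [-w(x_2),w(x_2)] is assumed uniform in x_2; with a bound depending on x_2 the claim fails, e.g. W_1=1, W_2=1/(1-x_2), Φ(x_2)=x_2+1. *)

(* Defs.v *)
From HB Require Import structures.
From mathcomp Require Export all_boot all_order all_algebra.
From mathcomp Require Export all_classical all_reals all_analysis.
Export numFieldNormedType.Exports.

Set Implicit Arguments.
Unset Strict Implicit.
Unset Printing Implicit Defensive.

Import Order.TTheory GRing.Theory Num.Theory.

Local Open Scope classical_set_scope.
Local Open Scope ring_scope.

(* Meant for an open set A of R or R * R: in finite dimension, continuity of
   all directional derivatives is continuity of the differential. *)
Definition C1_on (R : realType) (V : normedModType R) (A : set V)
    (f : V -> R) : Prop :=
  forall p, A p ->
    differentiable f p /\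
    forall v : V, {for p, continuous (fun x : V => 'D_v f x)}.

Definition C1_diffeo_on (R : realType) (A : set R) (Phi : R -> R) : Prop :=
  [/\ C1_on A Phi, open (Phi @` A) &
      exists Psi : R -> R,
        C1_on (Phi @` A) Psi /\ {in A, cancel Phi Psi}].

Definition Iopen {R : realType} : set R := [set` `]-1, 1[ ].

Definition leb3 (R : realType) :
    {measure set (measurableTypeR R * measurableTypeR R * measurableTypeR R)
       -> \bar R} :=
  ((@lebesgue_measure R \x @lebesgue_measure R) \x @lebesgue_measure R)%E.

Section L2.
Context {R : realType}.
Implicit Types (D : set (R * R * R)) (f g : R * R * R -> R).

(* Elements of L^2(D) are represented by Borel functions, which only matter on
   D: f \_ D is the extension of the restriction of f to D by zero. *)
Definition L2_on D : set (R * R * R -> R) :=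
  [set f | f \_ D \in Lfun (leb3 R) 2%:E].

Definition L2norm_on D f : \bar R := ('N[leb3 R]_2%:E[EFin \o (f \_ D)])%E.

Definition L2_compact_support D : set (R * R * R -> R) :=
  [set f | L2_on D f /\
    exists K : set (R * R * R), [/\ compact K, K `<=` D &
      {ae leb3 R, forall x, D x -> ~ K x -> f x = 0}]].

Definition ae_eq_on D f g : Prop :=
  {ae leb3 R, forall x, D x -> f x = g x}.

(* T acts on representatives; the second and third clauses say that it induces
   a linear map between spaces of classes modulo a.e. equality. *)
Definition L2_bounded_operator DX DY (X : set (R * R * R -> R))
    (T : (R * R * R -> R) -> (R * R * R -> R)) : Prop :=
  [/\ forall f, X f -> L2_on DY (T f),
      forall f g, X f -> X g -> ae_eq_on DX f g -> ae_eq_on DY (T f) (T g),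
      forall (a : R) f g, X f -> X g ->
        ae_eq_on DY (T (fun x => a * f x + g x))
                    (fun x => a * T f x + T g x) &
      exists C : R, 0 <= C /\
        forall f, X f -> (L2norm_on DY (T f) <= C%:E * L2norm_on DX f)%E].

End L2.

Section Bragg.
Context {R : realType}.
Variables (Em EM beta : R).

Definition Eint : set R := [set` `[Em, EM] ].

Definition bragg_dom : set (R * R * R) := Eint `*` setT `*` Iopen.

Definition bragg_codom (Phi : R -> R) : set (R * R * R) :=
  Eint `*` setT `*` (Phi @` Iopen).

Definition bragg_w (x2 : R) : R := (1 + x2) * tan (beta / 2).

(* Boundedness of W2 on this set is boundedness of the slices W2(., x2) on
   [-w(x2), w(x2)] with a bound independent of x2. For a fixed x2 a bound is
   automatic by compactness, and with x2-dependent bounds the transform need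
   not be bounded: take W1 = 1 and W2(x1, x2) = (1 - x2)^-1. *)
Definition bragg_window : set (R * R) :=
  [set x | Iopen x.2 /\ x.1 \in `[- bragg_w x.2, bragg_w x.2] ].

Definition q1 (x1 x2 : R) : R :=
  (Num.sqrt 2)^-1 *
  Num.sqrt (1 + (x1 ^+ 2 - (1 - x2 ^+ 2)) /
    (Num.sqrt (x1 ^+ 2 + (x2 + 1) ^+ 2) *
     Num.sqrt (x1 ^+ 2 + (1 - x2) ^+ 2))).

(* f \_ bragg_dom extends f by zero to values of its first variable outside
   [Em, EM]. *)
Definition bragg_integrand (W : R -> R -> R -> R) (f : R * R * R -> R)
    (E s1 x2 x1 : R) : R :=
  \1_[set` `[- bragg_w x2, bragg_w x2] ] (x1 - s1) * W E (x1 - s1) x2 *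
  (f \_ bragg_dom) (E * q1 (x1 - s1) x2, x1, x2).

(* The third coordinate of the argument is y = Phi x2. *)
Definition bragg (W : R -> R -> R -> R) (Phi : R -> R) (f : R * R * R -> R)
    (p : R * R * R) : R :=
  let: (E, s1, y) := p in
  \int[lebesgue_measure]_x1
    bragg_integrand W f E s1 (pinv Iopen Phi y) x1.

End Bragg.

(* Main.v *)
(** Where f(E q_1, x_1, x_2) does not vanish, both E and E q_1 lie in [Em, EM],
    so q_1 >= Em/EM although q_1 vanishes at x_1 = 0. The window has length at
    most 4 |tan (beta/2)| and the weight is bounded on it, so Cauchy-Schwarz
    bounds |B f|^2 pointwise by a constant times the integral of |f|^2 over the
    window. Integrating with Tonelli, the substitution E' = E q_1 costs a factor
    EM/Em, the integral in s_1 the length of the window, and the substitution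
    y = Phi(x_2) the supremum of |Phi'|. For these substitutions an upper bound
    suffices: if |y - y'| <= c |psi y - psi y'| on Y, then the integral of h o psi
    over Y is at most c times the integral of h. *)

From HB Require Import structures.
Require Import Defs.
From mathcomp Require Import all_boot all_order all_algebra.
From mathcomp Require Import all_classical all_reals all_analysis.
From mathcomp Require Import measurable_realfun lra.
Import Order.TTheory GRing.Theory Num.Theory.
Import numFieldNormedType.Exports.

Local Open Scope classical_set_scope.
Local Open Scope ring_scope.

(** * Substitution inequalities for Lebesgue measure on the line *)

Section expansive_substitution.
Context {R : realType}.
Local Notation mu := (@lebesgue_measure R).

(* lebesgue_measure is the outer measure built from lengths of half-open
   intervals, so it is enough to compare on these. *)
Lemma measure_le_scale_lebesgue
    (nu : {measure set (measurableTypeR R) -> \bar R}) (c : R) :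
  0 < c -> (forall a b : R, a < b -> (nu `]a, b]%classic <= (c * (b - a))%:E)%E) ->
  forall A, measurable A -> (nu A <= c%:E * mu A)%E.
Proof.
move=> c0 nuc A mA; rewrite -lee_pdivrMl// /lebesgue_measure.
rewrite /lebesgue_stieltjes_measure /measure_extension /mu_ext.
apply: le_ereal_inf_tmp => _ [F [mF AF] <-]; rewrite lee_pdivrMl//.
have mF' i : measurable (F i : set (measurableTypeR R)).
  exact: sub_sigma_algebra.
apply: (le_trans (measure_sigma_subadditive _ mF' mA AF)).
rewrite -nneseriesZl//; apply: lee_nneseries => // i _.
have [->|[[a b] /= ab ->]] := (ocitvP _).1 (mF i).
  by rewrite !measure0 mule0.
by rewrite wlength_itv /= lte_fin ab -EFinB -EFinM; exact: nuc.
Qed.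

(** Any two points of the preimage lie within [c * (b - a)] of each other, so it fits into an
    interval of that length starting at its infimum. *)
Lemma lebesgue_measure_expansive_preimage (c : R) (Y : set R)
    (psi : measurableTypeR R -> measurableTypeR R) :
  0 < c -> measurable Y -> measurable_fun setT psi ->
  {in Y &, forall y y', `|y - y'| <= c * `|psi y - psi y'|} ->
  forall a b : R, a < b ->
  (mu (psi @^-1` `]a, b]%classic `&` Y) <= (c * (b - a))%:E)%E.
Proof.
move=> c0 mY mpsi exppsi a b ab; set S := _ `&` _.
have mS : measurable S.
  by apply: measurableI => //; rewrite -[X in measurable X]setTI; exact: mpsi.
have [->|/set0P[y0 Sy0]] := eqVneq S set0.
  by rewrite measure0 lee_fin mulr_ge0 ?subr_ge0 ?ltW.
have diamS y y' : S y -> S y' -> y - c * (b - a) <= y'.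
  move=> [/=]; rewrite in_itv/= => /andP[ay yb] Yy.
  move=> [/=]; rewrite in_itv/= => /andP[ay' yb'] Yy'.
  rewrite lerBlDl -lerBlDr (le_trans (ler_norm _))//.
  rewrite (le_trans (exppsi _ _ _ _))// ?inE// ler_pM2l//.
  by rewrite ler_norml; apply/andP; split; lra.
have lbS : has_lbound S by exists (y0 - c * (b - a)) => y; exact: diamS.
have SI : S `<=` `[inf S, inf S + c * (b - a)].
  move=> y Sy /=; rewrite in_itv/= ge_inf//= -lerBlDr.
  by apply: lb_le_inf => //; [exists y0 | move=> y'; exact: diamS].
apply: (@le_trans _ _ (mu `[inf S, inf S + c * (b - a)]%classic)).
  by apply: le_measure => //; rewrite inE.
rewrite lebesgue_measure_itv/= lte_fin ltrDl mulr_gt0 ?subr_gt0//.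
by rewrite -EFinB addrAC subrr add0r.
Qed.

(** The left side integrates [h] against the pushforward by [psi] of Lebesgue measure restricted to
    [Y]. This pushforward is at most [c] times Lebesgue measure on half-open intervals, hence on all
    Borel sets, and the integral is monotone in the measure. *)
Lemma ge0_integral_expansive (c : R) (Y : set R)
    (psi : measurableTypeR R -> measurableTypeR R)
    (h : measurableTypeR R -> \bar R) :
  0 < c -> measurable Y -> measurable_fun setT psi ->
  {in Y &, forall y y', `|y - y'| <= c * `|psi y - psi y'|} ->
  measurable_fun setT h -> (forall x, 0 <= h x)%E ->
  (\int[mu]_(y in Y) h (psi y) <= c%:E * \int[mu]_x h x)%E.
Proof.
move=> c0 mY mpsi exppsi mh h0.
have mhpsi : measurable_fun setT (h \o psi) by exact: measurableT_comp.
have -> : (\int[mu]_(y in Y) h (psi y) =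
    \int[pushforward (mrestr mu mY) psi]_x h x)%E.
  rewrite (ge0_integral_pushforward mpsi)// preimage_setT.
  (* The complement of [Y] is null for the restricted measure, and on subsets of [Y] that measure is
     [mu]. *)
  rewrite (@ge0_negligible_integral _ (measurableTypeR R) _ _ setT (~` Y))//.
  - rewrite setTD setCK; apply: eq_measure_integral => A mA AY.
    by rewrite /= /mrestr setIidl.
  - exact: measurableC.
  - by move=> x _; exact: h0.
  - by rewrite /= /mrestr setICl measure0.
(* Scaling of measures takes a bundled nonnegative number. *)
have cE : c%:E = (NngNum (ltW c0))%:num%:E by [].
rewrite cE -ge0_integral_mscale//.
apply: ge0_le_measure_integral => // A mA.
apply: measure_le_scale_lebesgue => // a b ab.
exact: lebesgue_measure_expansive_preimage.
Qed.

Lemma lebesgue_measure_itv_centered (x r : R) : 0 <= r ->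
  mu `[x - r, x + r]%classic = (2 * r)%:E.
Proof.
move=> r0; rewrite lebesgue_measure_itv/= lte_fin -EFinB.
case: ltP => [_|]; first by congr EFin; lra.
rewrite lerD2l => rN; have -> : r = 0; last by rewrite mulr0.
by apply: le_anti; rewrite r0 andbT (le_trans rN) ?oppr_le0.
Qed.

End expansive_substitution.

(** * Borel measurability in the plane and of [q1] *)

Section measurability.
Context {R : realType}.
Local Notation RT := (measurableTypeR R).

(** Measurability refers to the product sigma-algebra, so an open set of the product topology is
    written as a countable union of squares with rational centres and radii [1 / (n + 1)]. *)
Lemma open_measurable_prod (U : set (R * R)) :
  open U -> measurable (U : set (RT * RT)).
Proof.
move=> oU.
pose B (i : rat * rat * nat) : set (RT * RT) :=
  ball (ratr i.1.1 : R) i.2.+1%:R^-1 `*` ball (ratr i.1.2 : R) i.2.+1%:R^-1.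
have -> : U = \bigcup_i (if `[< B i `<=` U >] then B i else set0).
  apply/seteqP; split => [p Up|p [i _]]; last by case: asboolP => // + Bp; exact.
  have /nbhs_ballP[e /= e0 eU] := open_nbhs_nbhs (conj oU Up).
  (* With radius below [e / 2], a square containing [p] stays inside the ball of radius [e] around
     [p]. *)
  have [n ne] : exists n : nat, n.+1%:R^-1 < e / 2.
    have /ltr_add_invr[n] : (0 : R) < e / 2 by rewrite divr_gt0.
    by rewrite add0r; exists n.
  have ball_rat (x : R) : exists q : rat, ball (ratr q : R) n.+1%:R^-1 x.
    have [|q] := @rat_in_itvoo _ (x - n.+1%:R^-1) (x + n.+1%:R^-1).
      by rewrite ltrBlDr -addrA ltrDl addr_gt0.
    by rewrite in_itv/= -ltr_distl => q_x; exists q.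
  have [[a pa] [b pb]] := (ball_rat p.1, ball_rat p.2).
  exists (a, b, n) => //; case: asboolP => //; case => q [/= qa qb].
  apply: eU; split => /=.
  - exact: (ball_splitr (le_ball (ltW ne) pa) (le_ball (ltW ne) qa)).
  - exact: (ball_splitr (le_ball (ltW ne) pb) (le_ball (ltW ne) qb)).
apply: countable_bigcupT_measurable => [|i]; first exact: countableP.
by case: ifPn => // _; apply: measurableX; exact: measurable_ball.
Qed.

Lemma open_continuous_measurable_prod (U : set (R * R)) (f : R * R -> R) :
  open U -> (forall p, U p -> {for p, continuous f}) ->
  measurable_fun (U : set (RT * RT)) (f : RT * RT -> RT).
Proof.
move=> oU cf; apply: (measurability _ (RGenOpens.measurableE R)).
move=> _ [_ [a [b ->]] <-]; apply: open_measurable_prod.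
rewrite openE => p [Up fp]; apply: filterI; first exact: open_nbhs_nbhs.
by apply: (cf _ Up); apply: open_nbhs_nbhs; split => //; exact: interval_open.
Qed.

(** Inversion is continuous away from 0, and the remaining singleton is measurable. *)
Lemma measurable_invr : measurable_fun setT (@GRing.inv R : RT -> RT).
Proof.
have -> : [set: RT] = [set 0] `|` [set~ 0] by rewrite setUv.
apply/measurable_funU => //; first exact: measurableC.
split; first exact: measurable_fun_set1.
apply: open_continuous_measurable_fun; first exact: closed_openC.
by move=> x; rewrite inE => /eqP x0; exact: inv_continuous.
Qed.

Lemma measurable_sqrtr : measurable_fun setT (@Num.sqrt R : RT -> RT).
Proof. by apply: continuous_measurable_fun; exact: sqrt_continuous. Qed.

(** Inversion and [Num.sqrt] are total, so the formula composes measurable maps on the whole plane,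
    even at [(0, 1)] and [(0, -1)], where the denominator vanishes. *)
Lemma measurable_q1 :
  measurable_fun setT (fun p : RT * RT => q1 p.1 p.2 : RT).
Proof.
pose m1 := measurable_fst : measurable_fun setT (@fst RT RT).
pose m2 := measurable_snd : measurable_fun setT (@snd RT RT).
rewrite /q1; apply: measurable_funM => //.
apply: (measurableT_comp measurable_sqrtr); apply: measurable_funD => //.
apply: measurable_funM.
  apply: measurable_funB; first exact: measurable_funX.
  by apply: measurable_funB => //; exact: measurable_funX.
apply: (measurableT_comp measurable_invr).
by apply: measurable_funM; apply: (measurableT_comp measurable_sqrtr);
  apply: measurable_funD; apply: measurable_funX => //;
  [exact: measurable_funD|exact: measurable_funB].
Qed.

End measurability.

(** * Cauchy-Schwarz for functions supported in a given set *)

Section cauchy_schwarz.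
Context d (T : measurableType d) (R : realType).
Variable mu : {measure set T -> \bar R}.

(** Hoelder's inequality with exponents 2 and 2 for the product of [\1_A] and [g], which equals [g];
    both sides are then squared. *)
Lemma poweR_integral_le (A : set T) (g : T -> R) :
  measurable A -> measurable_fun setT g -> (forall x, ~ A x -> g x = 0) ->
  ((\int[mu]_x `|g x|%:E) `^ 2 <= mu A * \int[mu]_x (`|g x| `^ 2)%:E)%E.
Proof.
move=> mA mg g0.
have -> : (\int[mu]_x `|g x|%:E = 'N[mu]_1[EFin \o (\1_A \* g)%R])%E.
  rewrite Lnorm1; apply: eq_integral => x _ /=; rewrite indicE.
  have [xA|xA] := boolP (x \in A); first by rewrite mul1r.
  by rewrite mul0r g0//; apply: contraNnot xA => ?; exact: mem_set.
have m1A : measurable_fun setT (\1_A : T -> R) by exact: measurable_indic.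
have := @hoelder _ _ _ mu \1_A g 2 2; rewrite [(_ + _)%R](_ : _ = 1); last first.
  by rewrite [RHS]splitr !div1r.
move=> /(_ m1A mg (ltr0Sn _ _) (ltr0Sn _ _) erefl) h.
have -> : (mu A * \int[mu]_x (`|g x| `^ 2)%:E =
   ('N[mu]_2%:E[EFin \o \1_A] * 'N[mu]_2%:E[EFin \o g]) `^ 2)%E.
  rewrite poweRM ?Lnorm_ge0// !poweR_Lnorm//; congr (_ * _)%E.
  rewrite -[LHS]mul1e -integral_cst// integral_mkcond; apply: eq_integral => x _.
  rewrite /= patchE indicE; case: (x \in A) => /=.
    by rewrite normr1 powR1.
  by rewrite normr0 powR0.
by apply: gt0_ler_poweR => //; rewrite in_itv/= leey ?mule_ge0 ?Lnorm_ge0.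
Qed.

End cauchy_schwarz.

(** * Sigma-finiteness of product measures *)

Section sigma_finite_product.
Local Open Scope ereal_scope.
Context d1 d2 (T1 : measurableType d1) (T2 : measurableType d2) (R : realType).
Variables (m1 : {sigma_finite_measure set T1 -> \bar R})
  (m2 : {sigma_finite_measure set T2 -> \bar R}).

(** The two exhaustions are chosen nondecreasing, so the diagonal rectangles [A n]*[B n] cover: a
    point in [A i]*[B j] lies in the one of index [maxn i j]. *)
Lemma sigma_finite_product_measure : sigma_finite setT (m1 \x m2).
Proof.
have /sigma_finiteP[A [UA ndA fA]] := sigma_finiteT m1.
have /sigma_finiteP[B [UB ndB fB]] := sigma_finiteT m2.
exists (fun n => A n `*` B n) => [|n]; last first.
  have [[mA Aoo] [mB Boo]] := (fA n, fB n); split; first exact: measurableX.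
  by rewrite product_measure1E// lte_mul_pinfty// ge0_fin_numE.
apply/esym; rewrite -subTset => -[x y] _.
have [i _ Aix] : (\bigcup_k A k) x by rewrite -UA.
have [j _ Bjy] : (\bigcup_k B k) y by rewrite -UB.
exists (maxn i j) => //; split => /=.
  by move/subsetPset : (ndA _ _ (leq_maxl i j)); apply.
by move/subsetPset : (ndB _ _ (leq_maxr i j)); apply.
Qed.

(* The library only registers m1 \x m2 as sigma-finite for probabilities. *)
Definition product_sigma_finite_measure :
    {sigma_finite_measure set (T1 * T2)%type -> \bar R} :=
  HB.pack (m1 \x m2)
    (Measure_isSigmaFinite.Build _ _ _ (m1 \x m2) sigma_finite_product_measure).
End sigma_finite_product.
Arguments product_sigma_finite_measure {d1 d2 T1 T2 R}.


(** * Tonelli estimate for a nonnegative kernel in four variables *)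

Section kernel_bound.
Context {R : realType}.
Local Notation RT := (measurableTypeR R).
Local Notation mu := (@lebesgue_measure R).
Local Open Scope ereal_scope.
Variables (Em EM L c : R) (Y : set R) (D : set (RT * RT)).
Variables (psi : RT -> RT) (q : RT * RT -> RT) (G : RT * RT * RT -> \bar R).
Hypotheses (Em_gt0 : (0 < Em)%R) (Em_lt_EM : (Em < EM)%R).
Hypotheses (L_ge0 : (0 <= L)%R) (c_gt0 : (0 < c)%R).
Hypotheses (mY : measurable Y) (mD : measurable D).
Hypotheses (mpsi : measurable_fun setT psi) (mq : measurable_fun setT q).
Hypotheses (mG : measurable_fun setT G) (G_ge0 : forall p, 0 <= G p).
Hypothesis D_sub : forall t z, D (t, z) -> (`|t| <= L)%R.
Hypothesis exppsi :
  {in Y &, forall y y' : R, `|y - y'| <= c * `|psi y - psi y'|}%R.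
Hypothesis G_supp : forall e x z, ~ Eint Em EM e -> G (e, x, z) = 0.

(** A tuple is an output point [(e, s, y)] followed by the integration variable [x]. Later [D] is
    the Bragg window, [psi] the inverse of [Phi], [q] is [q1], and [G] is the square of [|f|]. *)
Definition kernel_dom : set (RT * RT * RT * RT) :=
  [set p | let: (e, s, y, x) := p in
    [/\ Eint Em EM e, Y y & D (x - s, psi y)%R]].

Definition kernel_map (p : RT * RT * RT * RT) : RT * RT * RT :=
  let: (e, s, y, x) := p in (e * q (x - s, psi y)%R, x, psi y)%R.

Definition kernel (p : RT * RT * RT * RT) : \bar R :=
  (\1_kernel_dom p)%:E * G (kernel_map p).

Let me : measurable_fun setT (fun p : RT * RT * RT * RT => p.1.1.1).
Proof. by do 2 apply: (measurableT_comp measurable_fst). Qed.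

Let ms : measurable_fun setT (fun p : RT * RT * RT * RT => p.1.1.2).
Proof.
by apply: (measurableT_comp measurable_snd);
  apply: (measurableT_comp measurable_fst).
Qed.

Let my : measurable_fun setT (fun p : RT * RT * RT * RT => p.1.2).
Proof. by apply: (measurableT_comp measurable_snd). Qed.

Let mtz : measurable_fun setT
  (fun p : RT * RT * RT * RT => (p.2 - p.1.1.2, psi p.1.2)%R : RT * RT).
Proof.
apply: measurable_fun_pair; last exact: (measurableT_comp mpsi my).
by apply: measurable_funB; [exact: measurable_snd | exact: ms].
Qed.

Lemma measurable_kernel_dom : measurable kernel_dom.
Proof.
have -> : kernel_dom = (fun p => p.1.1.1) @^-1` Eint Em EM `&`
    ((fun p => p.1.2) @^-1` Y `&`
     (fun p => (p.2 - p.1.1.2, psi p.1.2)%R) @^-1` D).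
  by apply/seteqP; split => -[[[e s] y] x] /=; [case|case => ? []]; split.
apply: measurableI; last apply: measurableI.
- by rewrite -[X in measurable X]setTI; apply: me => //; exact: measurable_itv.
- by rewrite -[X in measurable X]setTI; apply: my.
- by rewrite -[X in measurable X]setTI; apply: mtz.
Qed.

Lemma measurable_kernel_map : measurable_fun setT kernel_map.
Proof.
have -> : kernel_map =
    fun p => (p.1.1.1 * q (p.2 - p.1.1.2, psi p.1.2)%R, p.2, psi p.1.2)%R.
  by apply/funext => -[[[e s] y] x].
apply: measurable_fun_pair; last exact: (measurableT_comp mpsi my).
apply: measurable_fun_pair; last exact: measurable_snd.
by apply: measurable_funM; [exact: me | exact: (measurableT_comp mq mtz)].
Qed.

Lemma measurable_kernel : measurable_fun setT kernel.
Proof.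
apply: emeasurable_funM; last first.
  exact: (measurableT_comp mG measurable_kernel_map).
by apply/measurable_EFinP; apply: measurable_indic; exact: measurable_kernel_dom.
Qed.

Lemma kernel_ge0 p : 0 <= kernel p.
Proof. by rewrite mule_ge0// lee_fin. Qed.

Let H (p : RT * RT) : \bar R := \int[mu]_e G (e, p.1, p.2).

(** Reassociated so that the energy alone is the first factor, the one integrated out in [H]. *)
Let mG' : measurable_fun setT (fun p : RT * (RT * RT) => G (p.1, p.2.1, p.2.2)).
Proof.
apply: (measurableT_comp mG); apply: measurable_fun_pair.
  apply: measurable_fun_pair; first exact: measurable_fst.
  exact: (measurableT_comp measurable_fst measurable_snd).
exact: (measurableT_comp measurable_snd measurable_snd).
Qed.

Let mH : measurable_fun setT H.
Proof.
exact: (@measurable_fun_fubini_tonelli_G _ _ _ _ _ mu _ mG' (fun=> G_ge0 _)).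
Qed.

Let H_ge0 p : 0 <= H p.
Proof. exact: integral_ge0. Qed.

(** If [q < Em / EM], then [e * q < Em] for every [e] in the energy interval, and the integrand
    vanishes by [G_supp]. Otherwise [e |-> e * q] satisfies the expansion inequality with constant
    [EM / Em]. The window is relaxed to [|x - s| <= L], which does not involve [y], so that the
    integral in [s] separates. *)
Let kernel_energy (s y x : R) :
  \int[mu]_e kernel (e, s, y, x) <=
  (\1_`[x - L, x + L]%classic s)%:E *
  ((\1_Y y)%:E * ((EM / Em)%:E * H (x, psi y))).
Proof.
have EM0 : (0 < EM)%R by exact: lt_trans Em_lt_EM.
have rhs_ge0 : 0 <= (\1_`[x - L, x + L]%classic s)%:E *
    ((\1_Y y)%:E * ((EM / Em)%:E * H (x, psi y))).
  by rewrite !mule_ge0// ?lee_fin// divr_ge0// ltW.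
have [[Yy Dxs]|YD] := pselect (Y y /\ D (x - s, psi y)%R); last first.
  rewrite integral0_eq// => e _; rewrite /kernel indicE memNset ?mul0e//.
  by move=> [_ Yy Dxs]; exact: YD.
have [qlt|qge] := ltP (q (x - s, psi y)%R : R) (Em / EM)%R.
  rewrite integral0_eq// => e _; rewrite /kernel indicE.
  have [/[!inE] -[+ _ _]|_] := boolP (_ \in _); last by rewrite mul0e.
  rewrite /Eint /= in_itv/= => /andP[Eme eEM].
  rewrite G_supp ?mule0// /Eint /= in_itv/= => /andP[+ _]; apply/negP.
  rewrite -ltNge; have e0 : (0 < e)%R by exact: lt_le_trans Eme.
  apply: (@lt_le_trans _ _ (e * (Em / EM))%R); first by rewrite ltr_pM2l.
  by rewrite mulrA ler_pdivrMr// mulrC ler_pM2l.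
have -> : (\1_`[x - L, x + L]%classic s = 1 :> R)%R.
  rewrite indicE mem_set//= in_itv/=.
  by move: (D_sub _ _ Dxs); rewrite ler_norml => /andP[]; lra.
have -> : (\1_Y y = 1 :> R)%R by rewrite indicE mem_set.
rewrite !mul1e.
apply: (@le_trans _ _
    (\int[mu]_(e in Eint Em EM) G (e * q (x - s, psi y), x, psi y)%R)).
  rewrite [leRHS]integral_mkcond le_eqVlt; apply/orP; left; apply/eqP.
  apply: eq_integral => e _; rewrite patchE /kernel indicE.
  have [eE|eE] := boolP (e \in Eint Em EM).
    by rewrite mem_set ?mul1e//; split => //; rewrite inE in eE.
  by rewrite memNset ?mul0e// => -[/mem_set]; rewrite (negbTE eE).
apply: (@ge0_integral_expansive _ (EM / Em) (Eint Em EM)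
  (fun e => e * q (x - s, psi y))%R (fun e => G (e, x, psi y))).
- by rewrite divr_gt0.
- exact: measurable_itv.
- exact: measurable_funM.
- move=> e e' _ _; rewrite -mulrBl normrM mulrCA ler_peMr//.
  have q0 : (0 <= q (x - s, psi y)%R)%R.
    by apply: le_trans qge; rewrite divr_ge0// ltW.
  rewrite ger0_norm// mulrAC ler_pdivlMr// mul1r.
  by move: qge; rewrite ler_pdivrMr// mulrC.
- by apply: (measurableT_comp mG); apply: measurable_fun_pair => //;
    apply: measurable_fun_pair.
- by move=> e; exact: G_ge0.
Qed.

Let kernel_window (y x : R) :
  \int[mu]_s \int[mu]_e kernel (e, s, y, x) <=
  (2 * L * (EM / Em))%:E * ((\1_Y y)%:E * H (x, psi y)).
Proof.
have mslice : measurable_fun setT (fun p : RT * RT => kernel (p, y, x)).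
  by apply: (measurableT_comp measurable_kernel);
    do 2 apply: measurable_fun_pair => //.
have C_ge0 : 0 <= (\1_Y y)%:E * ((EM / Em)%:E * H (x, psi y)).
  by rewrite !mule_ge0// lee_fin// divr_ge0// ltW// (lt_trans Em_gt0).
have mI : measurable_fun setT
    (fun s : RT => (\1_`[x - L, x + L]%classic s)%:E : \bar R).
  by apply/measurable_EFinP; exact: measurable_indic.
apply: (@le_trans _ _ (\int[mu]_s ((\1_`[x - L, x + L]%classic s)%:E *
    ((\1_Y y)%:E * ((EM / Em)%:E * H (x, psi y)))))).
  apply: ge0_le_integral => //.
  - by move=> s _; apply: integral_ge0 => e _; exact: kernel_ge0.
  - exact: (@measurable_fun_fubini_tonelli_G _ _ _ _ _ mu _ mslice
      (fun=> kernel_ge0 _)).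
  - by apply: emeasurable_funM.
rewrite ge0_integralZr//.
rewrite integral_indic// setIT /= lebesgue_measure_itv_centered//.
by rewrite (EFinM (2 * L)) -muleA (muleCA (EM / Em)%:E).
Qed.

(** The product measures of [leb3], carrying the sigma-finite structure that Tonelli's theorem asks
    of each factor. *)
Let mu2 := product_sigma_finite_measure mu mu.
Let mu3 := product_sigma_finite_measure mu2 mu.

(** Tonelli makes [x] the outermost variable and [y] the next, leaving [s] and [e] to
    [kernel_window]. Substituting [z = psi y] then costs the factor [c], and the iterated integral
    of [H] reassembles into that of [G]. *)
Lemma kernel_bound :
  \int[leb3 R]_p \int[mu]_x kernel (p, x) <=
  (2 * L * (EM / Em) * c)%:E * \int[leb3 R]_p G p.
Proof.
have C_ge0 : (0 <= 2 * L * (EM / Em))%R.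
  by rewrite !mulr_ge0 ?invr_ge0// ltW// (lt_trans Em_gt0).
have H'_ge0 x y : 0 <= (\1_Y y)%:E * H (x, psi y) by rewrite mule_ge0// lee_fin.
have mslice x : measurable_fun setT (fun p => kernel (p, x)).
  by apply: (measurableT_comp measurable_kernel); apply: measurable_fun_pair.
have mslice2 x y : measurable_fun setT (fun p : RT * RT => kernel (p, y, x)).
  by apply: (measurableT_comp (mslice x)); apply: measurable_fun_pair.
have mHx x : measurable_fun setT (fun z => H (x, z)).
  by apply: (measurableT_comp mH); apply: measurable_fun_pair.
have mH' x : measurable_fun setT (fun y : RT => (\1_Y y)%:E * H (x, psi y)).
  apply: emeasurable_funM.
    by apply/measurable_EFinP; exact: measurable_indic.
  exact: (measurableT_comp (mHx x)).
rewrite /leb3 (@fubini_tonelli _ _ _ _ _ mu3 mu _ measurable_kernel kernel_ge0).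
have slice_bound x :
    \int[mu3]_p kernel (p, x) <=
    (2 * L * (EM / Em) * c)%:E * \int[mu]_z H (x, z).
  rewrite (@fubini_tonelli2 _ _ _ _ _ mu2 mu _ (mslice x) (fun=> kernel_ge0 _)).
  rewrite /fubini_G.
  apply: (@le_trans _ _ (\int[mu]_y
      ((2 * L * (EM / Em))%:E * ((\1_Y y)%:E * H (x, psi y))))).
    apply: ge0_le_integral => //.
    - by move=> y _; apply: integral_ge0 => p _; exact: kernel_ge0.
    - exact: (@measurable_fun_fubini_tonelli_G _ _ _ _ _ mu2 _ (mslice x)
        (fun=> kernel_ge0 _)).
    - exact: measurable_funeM.
    - move=> y _.
      rewrite (@fubini_tonelli2 _ _ _ _ _ mu mu _ (mslice2 x y)
        (fun=> kernel_ge0 _)).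
      exact: kernel_window.
  rewrite ge0_integralZl// (EFinM _ c) -muleA.
  apply: lee_wpmul2l; first by rewrite lee_fin.
  (* The indicator becomes the domain of integration, since [psi] is expansive only on [Y]. *)
  have -> : \int[mu]_y ((\1_Y y)%:E * H (x, psi y)) =
      \int[mu]_(y in Y) H (x, psi y).
    rewrite [RHS]integral_mkcond; apply: eq_integral => y _.
    by rewrite patchE indicE; case: (y \in Y); rewrite ?mul1e ?mul0e.
  exact: (@ge0_integral_expansive _ c Y psi (fun z => H (x, z))).
apply: (@le_trans _ _
    (\int[mu]_x ((2 * L * (EM / Em) * c)%:E * \int[mu]_z H (x, z)))).
  apply: ge0_le_integral => //.
  - by move=> x _; apply: integral_ge0 => p _; exact: kernel_ge0.
  - exact: (@measurable_fun_fubini_tonelli_G _ _ _ _ _ mu3 _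
      measurable_kernel kernel_ge0).
  - apply: measurable_funeM.
    exact: (@measurable_fun_fubini_tonelli_F _ _ _ _ _ mu _ mH H_ge0).
rewrite ge0_integralZl//; last 3 first.
- exact: (@measurable_fun_fubini_tonelli_F _ _ _ _ _ mu _ mH H_ge0).
- by move=> x _; apply: integral_ge0 => z _.
- by rewrite lee_fin mulr_ge0// ltW.
(* Both sides are brought to an outer integral over [z]; for fixed [z], Tonelli in [e] and [x]
   identifies the slices. *)
rewrite (@fubini_tonelli2 _ _ _ _ _ mu2 mu _ mG G_ge0).
rewrite (@fubini_tonelli _ _ _ _ _ mu mu _ mH H_ge0).
rewrite le_eqVlt; apply/orP; left; apply/eqP; congr (_ * _).
apply: eq_integral => z _.
have mGz : measurable_fun setT (fun p => G (p, z)).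
  by apply: (measurableT_comp mG); apply: measurable_fun_pair.
exact/esym/(@fubini_tonelli2 _ _ _ _ _ mu mu _ mGz (fun=> G_ge0 _)).
Qed.

End kernel_bound.

(** * The inverse of [Phi] *)

Section diffeo.
Context {R : realType}.
Local Notation RT := (measurableTypeR R).
Variable Phi : R -> R.
Hypothesis Phi_diffeo : C1_diffeo_on Iopen Phi.

(** Extension by zero gives a measurable function on the whole line, and its values stay in (-1, 1)
    because 0 does. *)
Definition diffeo_inv : R -> R := pinv Iopen Phi \_ (Phi @` Iopen).

Lemma diffeo_pinvK : {in Iopen, cancel Phi (pinv Iopen Phi)}.
Proof.
have [_ _ [Psi [_ PsiK]]] := Phi_diffeo.
by apply: pinvKV => x y xI yI Pxy; rewrite -(PsiK x)// Pxy PsiK.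
Qed.

Lemma diffeo_invE y : (Phi @` Iopen) y -> diffeo_inv y = pinv Iopen Phi y.
Proof. by move=> Vy; rewrite /diffeo_inv patchE mem_set. Qed.

Lemma diffeo_invK x : Iopen x -> diffeo_inv (Phi x) = x.
Proof.
move=> Ix; rewrite diffeo_invE; last by exists x.
by rewrite diffeo_pinvK// inE.
Qed.

Lemma diffeo_inv_Iopen y : Iopen (diffeo_inv y).
Proof.
have [[x Ix <-]|Vy] := pselect ((Phi @` Iopen) y); first by rewrite diffeo_invK.
by rewrite /diffeo_inv patchE memNset// /Iopen /= in_itv/= ltrN10 ltr01.
Qed.

Lemma measurable_diffeo_range : measurable (Phi @` Iopen).
Proof. by have [_ oV _] := Phi_diffeo; exact: open_measurable. Qed.

(** On the open image of [Phi], [pinv] agrees with [Psi], which is continuous there. *)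
Lemma measurable_diffeo_inv : measurable_fun setT (diffeo_inv : RT -> RT).
Proof.
apply/(measurable_restrictT _ _).1; first exact: measurable_diffeo_range.
have [_ oV [Psi [C1Psi PsiK]]] := Phi_diffeo.
apply: (eq_measurable_fun Psi) => [_ /[!inE] -[x Ix <-]|].
  by rewrite diffeo_pinvK ?PsiK ?inE.
apply: open_continuous_measurable_fun => // y /[!inE] Vy.
exact/differentiable_continuous/(C1Psi y Vy).1.
Qed.

(** By the mean value theorem [Phi] is Lipschitz with any bound of its derivative as constant; read
    through the inverse, this is the expansion inequality. *)
Lemma diffeo_expansive : [bounded derive1 Phi x | x in Iopen] ->
  exists2 c, 0 < c & {in Phi @` Iopen &, forall y y',
    `|y - y'| <= c * `|diffeo_inv y - diffeo_inv y'|}.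
Proof.
move=> /ex_strict_bound_gt0 [c c0 Phi_c]; exists c => //.
have [C1Phi _ _] := Phi_diffeo.
have dPhi x : Iopen x -> derivable Phi x 1.
  by move=> Ix; apply/derivable1_diffP; exact: (C1Phi x Ix).1.
suff lip x x' : Iopen x -> Iopen x' -> x <= x' ->
    `|Phi x - Phi x'| <= c * `|x - x'|.
  move=> _ _ /[!inE] -[x Ix <-] [x' Ix' <-]; rewrite !diffeo_invK//.
  have [xx'|/ltW xx'] := leP x x'; first exact: lip.
  by rewrite distrC [X in c * X]distrC; exact: lip.
move=> Ix Ix'; rewrite le_eqVlt => /orP[/eqP ->|xx'].
  by rewrite !subrr normr0 mulr0.
have sub z : z \in `[x, x'] -> Iopen z.
  move: Ix Ix'; rewrite /Iopen /= !in_itv/= => /andP[x1 _] /andP[_ x'1].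
  by move=> /andP[xz zx']; rewrite (lt_le_trans x1)// (le_lt_trans zx').
rewrite distrC [X in c * X]distrC.
have [||z zI ->] := @MVT R Phi (derive1 Phi) x x' xx'.
- move=> z zI; apply: DeriveDef; last by rewrite derive1E.
  by apply: dPhi; apply: sub; exact: subset_itv_oo_cc.
- by apply: derivable_within_continuous => z zI; apply: dPhi; exact: sub.
rewrite normrM ler_wpM2r// ltW//; apply: Phi_c; apply: sub.
exact: subset_itv_oo_cc.
Qed.

End diffeo.

(** The integral is by definition the difference of those of the positive and negative parts, even
    where both are infinite; Tonelli gives the measurability of each. *)
Lemma measurable_integral_param d1 d2 (T1 : measurableType d1)
    (T2 : measurableType d2) (R : realType)
    (m : {sigma_finite_measure set T2 -> \bar R}) (k : T1 * T2 -> \bar R) :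
  measurable_fun setT k -> measurable_fun setT (fun p => \int[m]_x k (p, x))%E.
Proof.
move=> mk.
have -> : (fun p => \int[m]_x k (p, x))%E =
    (fun p => fubini_F m k^\+ p - fubini_F m k^\- p)%E.
  apply/funext => p; rewrite /fubini_F [LHS]integralE.
  by congr (_ - _)%E; apply: eq_integral => x _; rewrite !(funeposE, funenegE).
have [mp mn] := (measurable_funepos mk, measurable_funeneg mk).
apply: emeasurable_funB.
  exact: (measurable_fun_fubini_tonelli_F _ mp (funepos_ge0 _)).
exact: (measurable_fun_fubini_tonelli_F _ mn (funeneg_ge0 _)).
Qed.

Lemma measurable_normr_powR d (T : measurableType d) (R : realType)
    (g : T -> R) (p : R) : measurable_fun setT g ->
  measurable_fun setT (fun x => (`|g x| `^ p)%:E).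
Proof.
move=> mg; apply/measurable_EFinP.
by apply: (measurableT_comp (measurable_powR p)); exact: measurableT_comp.
Qed.

#[local] Instance leb3_ae_filter (R : realType) :
  Filter (nbhs (almost_everywhere (leb3 R))).
Proof. exact: (ae_filter_ringOfSetsType (leb3 R)). Qed.

(** * Representatives of L^2 functions on a domain *)

Section L2_on.
Context {R : realType}.
Local Notation RT := (measurableTypeR R).
Implicit Types (D : set (R * R * R)) (f g : R * R * R -> R).

Lemma L2_onP D f : L2_on D f <->
  measurable_fun setT (f \_ D : RT * RT * RT -> RT) /\ (L2norm_on D f < +oo)%E.
Proof.
split; first by move=> /andP[+ +]; rewrite !inE.
by move=> [mf f2]; apply/andP; rewrite !inE.
Qed.

Lemma L2norm_onE D f :
  (L2norm_on D f = (\int[leb3 R]_p (`|(f \_ D) p| `^ 2)%:E) `^ 2^-1)%E.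
Proof. by rewrite /L2norm_on unlock. Qed.

Lemma restrict_linear D (a : R) f g :
  (fun x => a * f x + g x) \_ D = fun x => a * (f \_ D) x + (g \_ D) x.
Proof.
by apply/funext => x; rewrite !patchE; case: ifP => // _; rewrite mulr0 addr0.
Qed.

(** Prepares the compatibility of the transform with a.e. equality. The difference is written
    [-1 * f + g] to match the linear combinations in [L2_bounded_operator]. *)
Lemma ae_eq_L2norm_on D f g :
  L2_on D f -> L2_on D g -> ae_eq_on D f g ->
  L2_on D (fun x => -1 * f x + g x) /\
  L2norm_on D (fun x => -1 * f x + g x) = 0%E.
Proof.
move=> /L2_onP[mf _] /L2_onP[mg _] fg.
have mh : measurable_fun setT
    ((fun x => -1 * f x + g x) \_ D : RT * RT * RT -> RT).
  by rewrite restrict_linear; apply: measurable_funD => //; exact: measurable_funM.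
suff n0 : L2norm_on D (fun x => -1 * f x + g x) = 0%E.
  by split => //; apply/L2_onP; split => //; rewrite n0.
rewrite L2norm_onE (ae_eq_integral (cst 0%E)) ?integral0 ?poweR0r//.
  exact: measurable_normr_powR.
apply: filterS fg => x fg _; rewrite /= restrict_linear !patchE.
case: ifPn => [/set_mem /fg ->|_]; last by rewrite mulr0 addr0 normr0 powR0.
by rewrite mulN1r addNr normr0 powR0.
Qed.

End L2_on.

(** * Estimates for the Bragg transform *)

Section bragg_operator.
Context {R : realType}.
Local Notation RT := (measurableTypeR R).
Local Notation mu := (@lebesgue_measure R).
Variables (Em EM beta : R) (Phi : R -> R) (W : R -> R -> R -> R).
Variables (W1 : R -> R) (W2 : R * R -> R).
Hypotheses (Em_gt0 : 0 < Em) (Em_lt_EM : Em < EM).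
Hypothesis Phi_diffeo : C1_diffeo_on Iopen Phi.
Hypothesis W_sep : forall E x1 x2 : R, 0 < E -> Iopen x2 ->
  W E x1 x2 = W1 E * W2 (x1, x2).
Hypothesis W1_C1 : C1_on [set E : R | 0 < E] W1.
Hypothesis W2_C1 : C1_on (setT `*` Iopen) W2.
Hypothesis W2_bnd : [bounded W2 x | x in bragg_window beta].
Hypothesis W1_bnd : [bounded W1 E | E in Eint Em EM].
Hypothesis dPhi_bnd : [bounded derive1 Phi x2 | x2 in Iopen].

Local Notation DX := (bragg_dom Em EM).
Local Notation DY := (bragg_codom Em EM Phi).
Local Notation V := (Phi @` Iopen).
Local Notation psi := (diffeo_inv Phi).
Local Notation q := (fun p : RT * RT => q1 p.1 p.2).
Local Notation S := (kernel_dom Em EM V (bragg_window beta) psi).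
Local Notation Q := (kernel_map psi q).

Lemma measurable_bragg_window :
  measurable (bragg_window beta : set (RT * RT)).
Proof.
have mw : measurable_fun setT (fun p : RT * RT => bragg_w beta p.2 : RT).
  apply: measurable_funM => //; apply: measurable_funD => //.
have -> : bragg_window beta = (snd @^-1` Iopen) `&`
    ((fun p => - bragg_w beta p.2 <= p.1) @^-1` [set true] `&`
     (fun p => p.1 <= bragg_w beta p.2) @^-1` [set true]).
  apply/seteqP; split => -[t z]; rewrite /bragg_window /= in_itv/=.
    by move=> [? /andP[-> ->]].
  by move=> [? [-> ->]].
apply: measurableI; last apply: measurableI.
- by rewrite -[X in measurable X]setTI; apply: measurable_snd => //;
    exact: measurable_itv.
- rewrite -[X in measurable X]setTI; apply: measurable_fun_ler => //.
  exact: measurable_funN.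
- by rewrite -[X in measurable X]setTI; apply: measurable_fun_ler.
Qed.

(** As [1 + x2 < 2] on (-1, 1), this bounds all half-widths [bragg_w] at once. *)
Let L := 2 * `|tan (beta / 2)|.

Let L_ge0 : 0 <= L.
Proof. by rewrite mulr_ge0. Qed.

Lemma bragg_window_sub t z : bragg_window beta (t, z) -> `|t| <= L.
Proof.
rewrite /bragg_window /Iopen /= !in_itv/= => -[/andP[z1 z2]].
rewrite -ler_norml => /le_trans; apply.
rewrite /bragg_w (le_trans (ler_norm _))// normrM ler_wpM2r//.
by rewrite ger0_norm; lra.
Qed.

(** The Bragg integrand made into a measurable function of all four variables: each weight is
    extended by zero from the set on which it is assumed bounded, and the indicator of [S] vanishes
    outside these sets. *)
Definition bragg_kernel (f : R * R * R -> R) (p : RT * RT * RT * RT) : R :=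
  \1_S p * ((W1 \_ (Eint Em EM)) p.1.1.1 *
    (W2 \_ (bragg_window beta)) (p.2 - p.1.1.2, psi p.1.2)) * (f \_ DX) (Q p).

Lemma bragg_kernelE f (p : R * R * R) (x : R) : DY p ->
  bragg_integrand Em EM beta W f p.1.1 p.1.2 (pinv Iopen Phi p.2) x =
  bragg_kernel f (p, x).
Proof.
case: p => [[E s] y] [[/= EI _] Vy].
rewrite /bragg_integrand /bragg_kernel/= -(diffeo_invE _ _ Vy).
have Iz := diffeo_inv_Iopen _ Phi_diffeo y.
have E0 : 0 < E.
  by move: EI; rewrite /Eint /= in_itv/= => /andP[+ _]; exact: lt_le_trans.
(* For an output point in [DY] the other conditions of [S] hold, so only the window inequality is
   left. *)
have windowE :
    (x - s \in [set` `[- bragg_w beta (psi y), bragg_w beta (psi y)]]) =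
    ((E, s, y, x) \in S).
  by apply/idP/idP => /set_mem xw; apply: mem_set; [split | case: xw => _ _ []].
rewrite W_sep// !indicE windowE !patchE (mem_set EI).
have [/set_mem[_ _ Dxs]|_] := boolP ((E, s, y, x) \in S); last by rewrite !mul0r.
by rewrite (mem_set Dxs).
Qed.

Let mV : measurable (V : set RT).
Proof. exact: measurable_diffeo_range. Qed.

Let mpsi : measurable_fun setT (psi : RT -> RT).
Proof. exact: measurable_diffeo_inv. Qed.

Let mq : measurable_fun setT (q : RT * RT -> RT).
Proof. exact: measurable_q1. Qed.

Let mS : measurable S.
Proof. by apply: measurable_kernel_dom => //; exact: measurable_bragg_window. Qed.

Let mQ : measurable_fun setT Q.
Proof. exact: measurable_kernel_map. Qed.

(** Differentiability makes [W1] continuous on the open half-line and [W2] on the open strip, hence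
    measurable on the smaller sets where they are kept. *)
Lemma measurable_bragg_kernel f :
  measurable_fun setT (f \_ DX : RT * RT * RT -> RT) ->
  measurable_fun setT (bragg_kernel f : _ -> RT).
Proof.
move=> mf; apply: measurable_funM; last exact: (measurableT_comp mf mQ).
apply: measurable_funM; first exact: measurable_indic.
have mE : measurable (Eint Em EM : set RT) by exact: measurable_itv.
apply: measurable_funM.
  suff mW1 : measurable_fun setT (W1 \_ (Eint Em EM) : RT -> RT).
    apply: (measurableT_comp mW1); apply: (measurableT_comp measurable_fst).
    exact: (measurableT_comp measurable_fst).
  apply: (iffLR (measurable_restrictT (W1 : RT -> RT) mE)).
  have sub : Eint Em EM `<=` [set E | 0 < E].
    by move=> E; rewrite /Eint /= in_itv/= => /andP[EmE _]; exact: lt_le_trans EmE.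
  have o0 : open [set E : R | 0 < E] by exact: open_gt.
  apply: (measurable_funS (open_measurable o0) sub).
  apply: open_continuous_measurable_fun => // E /[!inE] E0.
  exact/differentiable_continuous/(W1_C1 E E0).1.
have mw := measurable_bragg_window.
have oI : open (setT `*` Iopen : set (R * R)).
  have -> : setT `*` Iopen = snd @^-1` Iopen :> set (R * R).
    by apply/seteqP; split => -[t z] //= [].
  by apply: open_comp => [? _|]; [exact: cvg_snd|exact: interval_open].
have mW2 : measurable_fun setT (W2 \_ (bragg_window beta) : RT * RT -> RT).
  apply: (iffLR (measurable_restrictT (W2 : RT * RT -> RT) mw)).
  have sub : bragg_window beta `<=` setT `*` Iopen by move=> [t z] [].
  apply: (measurable_funS (open_measurable_prod _ oI) sub).
  apply: (open_continuous_measurable_prod _ _ oI) => p Ip.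
  exact/differentiable_continuous/(W2_C1 p Ip).1.
have mtz : measurable_fun setT (fun p : RT * RT * RT * RT =>
    (p.2 - p.1.1.2, psi p.1.2) : RT * RT).
  apply: measurable_fun_pair.
    apply: measurable_funB; first exact: measurable_snd.
    apply: (measurableT_comp measurable_snd).
    exact: (measurableT_comp measurable_fst).
  apply: (measurableT_comp mpsi); exact: (measurableT_comp measurable_snd).
exact: (measurableT_comp mW2 mtz).
Qed.

Lemma bragg_kernel_window f p x :
  ~ `[p.1.2 - L, p.1.2 + L]%classic x -> bragg_kernel f (p, x) = 0.
Proof.
case: p => [[E s] y] /=; rewrite in_itv/= => xs.
rewrite /bragg_kernel indicE memNset ?mul0r// => -[_ _ /bragg_window_sub].
by rewrite ler_norml => /andP[? ?]; apply: xs; apply/andP; split; lra.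
Qed.

Let G (f : R * R * R -> R) (p : RT * RT * RT) : \bar R := (`|(f \_ DX) p| `^ 2)%:E.

(** With [C1] and [C2] bounding the two weights, the squared integrand is at most [(C1 * C2) ^ 2]
    times [kernel] for the square of [|f|], and [kernel_bound] applies. *)
Lemma bragg_kernel_energy : exists2 C : R, 0 <= C & forall f,
  measurable_fun setT (f \_ DX : RT * RT * RT -> RT) ->
  (\int[leb3 R]_p \int[mu]_x (`|bragg_kernel f (p, x)| `^ 2)%:E <=
   C%:E * \int[leb3 R]_p (`|(f \_ DX) p| `^ 2)%:E)%E.
Proof.
have [C1 C1_gt0 W1C] := ex_strict_bound_gt0 W1_bnd.
have [C2 C2_gt0 W2C] := ex_strict_bound_gt0 W2_bnd.
have [c c_gt0 exppsi] := diffeo_expansive _ Phi_diffeo dPhi_bnd.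
have EM_gt0 : 0 < EM by exact: lt_trans Em_lt_EM.
exists ((C1 * C2) `^ 2 * (2 * L * (EM / Em) * c)) => [|f mf].
  by rewrite !mulr_ge0 ?powR_ge0 ?invr_ge0// ltW.
have mG : measurable_fun setT (G f) by exact: measurable_normr_powR.
have G_ge0 p : (0 <= G f p)%E by rewrite lee_fin powR_ge0.
have G_supp (e : R) (x z : RT) : ~ Eint Em EM e -> G f (e, x, z) = 0%E.
  move=> eE; rewrite /G patchE memNset ?normr0 ?powR0//.
  by move=> [[]].
have mD := measurable_bragg_window.
pose K := kernel Em EM V (bragg_window beta) psi q (G f).
have mK : measurable_fun setT K by exact: measurable_kernel.
have K_ge0 p : (0 <= K p)%E by exact: kernel_ge0.
have kK p : ((`|bragg_kernel f p| `^ 2)%:E <= ((C1 * C2) `^ 2)%:E * K p)%E.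
  rewrite /bragg_kernel /K /kernel !indicE.
  have [/set_mem|_] := boolP (p \in S); last first.
    by rewrite !mul0r normr0 powR0// mul0e mule0.
  case: p => [[[E s] y] x] [EI Vy Dxs]; rewrite !mul1r mul1e /G -EFinM lee_fin.
  rewrite normrM powRM// ler_wpM2r ?powR_ge0//.
  apply: ge0_ler_powR; rewrite ?nnegrE ?(mulr_ge0 (ltW C1_gt0)) ?(ltW C2_gt0)//.
  by rewrite normrM !patchE !mem_set// ler_pM//; apply: ltW; [exact: W1C|exact: W2C].
rewrite EFinM -muleA.
apply: (@le_trans _ _ (((C1 * C2) `^ 2)%:E * \int[leb3 R]_p \int[mu]_x K (p, x))%E);
  last first.
  apply: lee_wpmul2l; first by rewrite lee_fin powR_ge0.
  by apply: (@kernel_bound _ _ _ L c) => //; exact: bragg_window_sub.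
have mKk : measurable_fun setT (fun p => (`|bragg_kernel f p| `^ 2)%:E).
  by apply: measurable_normr_powR; exact: measurable_bragg_kernel.
rewrite -ge0_integralZl//; last 3 first.
- exact: (@measurable_fun_fubini_tonelli_F _ _ _ _ _ mu _ mK K_ge0).
- by move=> p _; apply: integral_ge0 => x _.
- by rewrite lee_fin powR_ge0.
apply: ge0_le_integral => //.
- by move=> p _; apply: integral_ge0 => x _; rewrite lee_fin powR_ge0.
- apply: (@measurable_fun_fubini_tonelli_F _ _ _ _ _ mu _ mKk) => p.
  by rewrite lee_fin powR_ge0.
- apply: measurable_funeM.
  exact: (@measurable_fun_fubini_tonelli_F _ _ _ _ _ mu _ mK K_ge0).
- move=> p _; rewrite -ge0_integralZl//; last 2 first.
  + by apply: (measurableT_comp mK); apply: measurable_fun_pair.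
  + by rewrite lee_fin powR_ge0.
  apply: ge0_le_integral => //.
  + by apply: (measurableT_comp mKk); apply: measurable_fun_pair.
  + apply: measurable_funeM.
    by apply: (measurableT_comp mK); apply: measurable_fun_pair.
Qed.

(** Outside [DY] the kernel vanishes, so one parameter integral describes the restricted transform
    everywhere; its measurability follows. *)
Lemma bragg_restrictE f (p : R * R * R) :
  (bragg Em EM beta W Phi f \_ DY) p =
  fine (\int[mu]_x (bragg_kernel f (p, x))%:E)%E.
Proof.
rewrite patchE; have [/set_mem Yp|Yp] := boolP (p \in DY).
  transitivity (fine (\int[mu]_x (bragg_integrand Em EM beta W f p.1.1 p.1.2
      (pinv Iopen Phi p.2) x)%:E)%E); first by case: (p) => [[E s] y].
  by congr fine; apply: eq_integral => x _; rewrite bragg_kernelE.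
rewrite integral0_eq// => x _; rewrite /bragg_kernel indicE memNset ?mul0r//.
move: Yp; case: p => [[E s] y] Yp [EI Vy _].
by move/negP: Yp; apply; apply: mem_set.
Qed.

Lemma integral_bragg_kernel_le f (p : R * R * R) :
  measurable_fun setT (f \_ DX : RT * RT * RT -> RT) ->
  ((\int[mu]_x `|bragg_kernel f (p, x)|%:E) `^ 2 <=
   (2 * L)%:E * \int[mu]_x (`|bragg_kernel f (p, x)| `^ 2)%:E)%E.
Proof.
move=> mf; rewrite -(@lebesgue_measure_itv_centered _ p.1.2) ?mulr_ge0//.
apply: poweR_integral_le => //; last by move=> x; exact: bragg_kernel_window.
apply: (measurableT_comp (measurable_bragg_kernel f mf)).
exact: measurable_fun_pair.
Qed.

(** Cauchy-Schwarz on an interval of length [2 * L], integrated over output points, meets the energy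
    bound with constant [C]; the square root of the product of the two factors bounds the norm. *)
Lemma L2_bragg : exists2 C : R, 0 <= C & forall f, L2_on DX f ->
  L2_on DY (bragg Em EM beta W Phi f) /\
  (L2norm_on DY (bragg Em EM beta W Phi f) <= C%:E * L2norm_on DX f)%E.
Proof.
have [C C_ge0 energy] := bragg_kernel_energy.
exists ((2 * L * C) `^ 2^-1) => [|f /L2_onP[mf f_fin]]; first exact: powR_ge0.
have mk : measurable_fun setT (fun q => (bragg_kernel f q)%:E).
  by apply/measurable_EFinP; exact: measurable_bragg_kernel.
have mB : measurable_fun setT
    (bragg Em EM beta W Phi f \_ DY : RT * RT * RT -> RT).
  rewrite (funext (bragg_restrictE f)); apply: measurableT_comp => //.
  exact: measurable_integral_param mk.
suff bnd : (L2norm_on DY (bragg Em EM beta W Phi f) <=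
    ((2 * L * C) `^ 2^-1)%:E * L2norm_on DX f)%E.
  split => //; apply/L2_onP; split => //; apply: (le_lt_trans bnd).
  by rewrite lte_mul_pinfty// ?lee_fin ?powR_ge0// ge0_fin_numE// Lnorm_ge0.
rewrite !L2norm_onE -poweR_EFin -poweRM; last 2 first.
- by rewrite lee_fin !mulr_ge0.
- by apply: integral_ge0 => p _; rewrite lee_fin powR_ge0.
apply: gt0_ler_poweR; rewrite ?in_itv/= ?leey ?andbT ?invr_ge0//.
- by apply: integral_ge0 => p _; rewrite lee_fin powR_ge0.
- rewrite mule_ge0// ?lee_fin ?mulr_ge0//.
  by apply: integral_ge0 => p _; rewrite lee_fin powR_ge0.
rewrite EFinM -muleA.
apply: (@le_trans _ _ ((2 * L)%:E *
    \int[leb3 R]_p \int[mu]_x (`|bragg_kernel f (p, x)| `^ 2)%:E)%E); last first.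
  by apply: lee_wpmul2l; [rewrite lee_fin mulr_ge0// | exact: energy].
have mk2 : measurable_fun setT (fun q => (`|bragg_kernel f q| `^ 2)%:E).
  by apply: measurable_normr_powR; exact: measurable_bragg_kernel.
have mI : measurable_fun setT
    (fun p => \int[mu]_x (`|bragg_kernel f (p, x)| `^ 2)%:E)%E.
  apply: (@measurable_fun_fubini_tonelli_F _ _ _ _ _ mu _ mk2) => p.
  by rewrite lee_fin powR_ge0.
rewrite -ge0_integralZl//; last 2 first.
- by move=> p _; apply: integral_ge0 => x _; rewrite lee_fin powR_ge0.
- by rewrite lee_fin mulr_ge0.
apply: ge0_le_integral => //.
- exact: measurable_normr_powR.
- exact: measurable_funeM.
move=> p _; apply: le_trans (integral_bragg_kernel_le f p mf).
rewrite bragg_restrictE -poweR_EFin.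
apply: gt0_ler_poweR; rewrite ?in_itv/= ?leey ?andbT ?lee_fin//.
  by apply: integral_ge0.
(* [fine] sends both infinities to 0, so it never increases the absolute value. *)
apply: (@le_trans _ _ `|\int[mu]_x (bragg_kernel f (p, x))%:E|%E).
  by case: (\int[mu]_x _)%E => [r||] /=; rewrite ?leey.
apply: le_abse_integral => //.
by apply: (measurableT_comp mk); exact: measurable_fun_pair.
Qed.

(** The energy bound makes the integral of the squared kernel in [x] finite for almost every output
    point; Cauchy-Schwarz on the bounded window turns this into integrability. *)
Lemma bragg_integrable f : L2_on DX f ->
  {ae leb3 R, forall p, DY p ->
     mu.-integrable setT (EFin \o bragg_integrand Em EM beta W f p.1.1 p.1.2
                                    (pinv Iopen Phi p.2))}.
Proof.
move=> /L2_onP[mf f_fin].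
have [C C_ge0 energy] := bragg_kernel_energy.
have mk := measurable_bragg_kernel f mf.
pose I (p : RT * RT * RT) := (\int[mu]_x (`|bragg_kernel f (p, x)| `^ 2)%:E)%E.
have I_ge0 p : (0 <= I p)%E.
  by apply: integral_ge0 => x _; rewrite lee_fin powR_ge0.
have I_int : (leb3 R).-integrable setT I.
  apply/integrableP; split.
    apply: (@measurable_integral_param _ _ _ _ _ mu
      (fun q => (`|bragg_kernel f q| `^ 2)%:E)).
    exact: measurable_normr_powR.
  under eq_integral do rewrite gee0_abs//.
  apply: (le_lt_trans (energy f mf)); rewrite lte_mul_pinfty ?lee_fin//.
  by rewrite L2norm_onE in f_fin; exact: lty_poweRy f_fin.
apply: filterS (integrable_ae measurableT I_int) => p /(_ Logic.I) I_fin Yp.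
have mkp : measurable_fun setT (fun x => (bragg_kernel f (p, x))%:E).
  apply/measurable_EFinP; apply: (measurableT_comp mk).
  exact: measurable_fun_pair.
rewrite (_ : _ \o _ = fun x => (bragg_kernel f (p, x))%:E); last first.
  by apply/funext => x /=; rewrite bragg_kernelE.
apply/integrableP; split => //.
apply: (@lty_poweRy _ _ 2) => //.
apply: (le_lt_trans (integral_bragg_kernel_le f p mf)).
by apply: lte_mul_pinfty; rewrite ?lee_fin ?mulr_ge0// -ge0_fin_numE//; exact: I_ge0.
Qed.

(** The integral is additive where both integrands are integrable, which [bragg_integrable] gives
    for almost every output point. *)
Lemma bragg_linear (a : R) f g : L2_on DX f -> L2_on DX g ->
  ae_eq_on DY (bragg Em EM beta W Phi (fun x => a * f x + g x))
    (fun x => a * bragg Em EM beta W Phi f x + bragg Em EM beta W Phi g x).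
Proof.
move=> /bragg_integrable f_int /bragg_integrable g_int.
apply: filterS2 f_int g_int => -[[E s] y] f_int g_int Yp.
have {f_int g_int}[f_int g_int] := (f_int Yp, g_int Yp).
rewrite /bragg -RintegralZl// -RintegralD//; last first.
  exact: (integrableZl measurableT a f_int).
apply: eq_Rintegral => x _.
by rewrite /bragg_integrand restrict_linear mulrDr mulrCA.
Qed.

(** Each value of the transform integrates along a curve, a null set of the domain, so a.e. equality
    does not transfer pointwise. Instead the norm bound sends [g - f], of norm 0, to a function of
    norm 0, and linearity concludes. *)
Lemma bragg_ae_eq f g : L2_on DX f -> L2_on DX g -> ae_eq_on DX f g ->
  ae_eq_on DY (bragg Em EM beta W Phi f) (bragg Em EM beta W Phi g).
Proof.
move=> L2f L2g fg.
have [C C_ge0 bnd] := L2_bragg.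
have [L2h h0] := ae_eq_L2norm_on _ _ _ L2f L2g fg.
have [/L2_onP[mTh _]] := bnd _ L2h; rewrite h0 mule0 => Th_le0.
have Th0 : L2norm_on DY (bragg Em EM beta W Phi (fun x => -1 * f x + g x)) = 0%E.
  by apply: le_anti; rewrite Th_le0 Lnorm_ge0.
have mTh' : measurable_fun [set: (RT * RT * RT)%type]
  (EFin \o (bragg Em EM beta W Phi (fun x => -1 * f x + g x) \_ DY)).
  exact/measurable_EFinP.
have two_gt0 : (0 < 2%:E :> \bar R)%E by rewrite lte_fin.
have ae0 := Lnorm_eq0_eq0 mTh' two_gt0 Th0.
apply: filterS2 ae0 (bragg_linear (-1) f g L2f L2g) => p /(_ Logic.I) /= + + Yp.
rewrite patchE mem_set// => -[->] /(_ Yp) /esym/eqP.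
by rewrite mulN1r addrC subr_eq0 => /eqP.
Qed.

End bragg_operator.

Theorem corollary4p4 (R : realType) (Em EM beta M : R)
    (Phi : R -> R) (W : R -> R -> R -> R) (W1 : R -> R) (W2 : R * R -> R)
    (Em_gt0 : 0 < Em) (Em_lt_EM : Em < EM)
    (beta_gt0 : 0 < beta) (beta_lt_pi : beta < pi)
    (Phi_diffeo : C1_diffeo_on Iopen Phi)
    (M_gt0 : 0 < M)
    (Phi_bnd : forall x2 : R, Iopen x2 -> 0 <= Phi x2 <= M)
    (W_sep : forall E x1 x2 : R, 0 < E -> Iopen x2 ->
      W E x1 x2 = W1 E * W2 (x1, x2))
    (W1_C1 : C1_on [set E : R | 0 < E] W1)
    (W2_C1 : C1_on (setT `*` Iopen) W2)
    (W1_neq0 : forall E : R, 0 < E -> W1 E != 0)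
    (W2_neq0 : forall x1 x2 : R, Iopen x2 -> W2 (x1, x2) != 0)
    (W2_sym : forall x1 x2 : R, Iopen x2 -> W2 (- x1, x2) = W2 (x1, x2))
    (W2_slice_C1 : forall x2 : R, Iopen x2 -> C1_on setT (fun x1 => W2 (x1, x2)))
    (W2_bnd : [bounded W2 x | x in bragg_window beta])
    (W2_der_bnd : forall x2 : R, Iopen x2 ->
      [bounded derive1 (fun t => W2 (t, x2)) x1
         | x1 in [set` `[- bragg_w beta x2, bragg_w beta x2] ] ])
    (W1_bnd : [bounded W1 E | E in Eint Em EM])
    (dPhi_bnd : [bounded derive1 Phi x2 | x2 in Iopen]) :
  (forall f, L2_compact_support (bragg_dom Em EM) f ->
     {ae leb3 R, forall p, bragg_codom Em EM Phi p ->
        lebesgue_measure.-integrable setT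
          (EFin \o bragg_integrand Em EM beta W f p.1.1 p.1.2
                     (pinv Iopen Phi p.2))}) /\
  L2_bounded_operator (bragg_dom Em EM) (bragg_codom Em EM Phi)
    (L2_compact_support (bragg_dom Em EM))
    (bragg Em EM beta W Phi).
Proof.
have bint := bragg_integrable Em EM beta Phi W W1 W2 Em_gt0 Em_lt_EM Phi_diffeo
  W_sep W1_C1 W2_C1 W2_bnd W1_bnd dPhi_bnd.
have blin := bragg_linear Em EM beta Phi W W1 W2 Em_gt0 Em_lt_EM Phi_diffeo
  W_sep W1_C1 W2_C1 W2_bnd W1_bnd dPhi_bnd.
have baeq := bragg_ae_eq Em EM beta Phi W W1 W2 Em_gt0 Em_lt_EM Phi_diffeo
  W_sep W1_C1 W2_C1 W2_bnd W1_bnd dPhi_bnd.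
have [C C_ge0 bnd] := L2_bragg Em EM beta Phi W W1 W2 Em_gt0 Em_lt_EM Phi_diffeo
  W_sep W1_C1 W2_C1 W2_bnd W1_bnd dPhi_bnd.
split=> [f [f2 _]|]; first exact: bint.
split=> [f [f2 _]|f g [f2 _] [g2 _]|a f g [f2 _] [g2 _]|].
- exact: (bnd f f2).1.
- exact: baeq.
- exact: blin.
- by exists C; split=> // f [f2 _]; exact: (bnd f f2).2.
Qed.
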